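(* Let $f:[0,1]\to\mathbb{R}$ be a convex function. Then the absolute value of the error of approximation of the operator $P_n^c$ is a non-decreasing function of $c$, that is, $$\left|P_n^{c_2}f(x)-f(x)\right|\ \ge\ \left|P_n^{c_1}f(x)-f(x)\right|$$ for any integer $n\ge 2$, any $x\in[0,1]$, and any real numbers $c_2>c_1\ge -\frac{1}{n-1}\min\{x,1-x\}$. If moreover $B_nf(x)\ne B_1f(x)$ for certain values of $n\ge 2$ and $x\in[0,1]$, then for these values of $n$ and $x$ the monotonicity is strict, that is, $$\left|P_n^{c_2}f(x)-f(x)\right|\ >\ \left|P_n^{c_1}f(x)-f(x)\right|$$ for any real numbers $c_2>c_1\ge -\frac{1}{n-1}\min\{x,1-x\}$.
   Context: For $y,h\in\mathbb{R}$ and an integer $m\ge 0$, the generalized rising factorial with increment $h$ is $y^{(m,h)}=y(y+h)(y+2h)\cdots(y+(m-1)h)$, with $y^{(0,h)}=1$ (empty product). For an integer $n\ge 1$, $x\in[0,1]$ and a real $c$ with $x+(n-1)c\ge0$ and $1-x+(n-1)c\ge 0$ (for $n\ge2$ this means $c\ge -\frac{1}{n-1}\min\{x,1-x\}$), put $$p_{n,k}^{x,1-x,c}=\binom{n}{k}\frac{x^{(k,c)}\,(1-x)^{(n-k,c)}}{1^{(n,c)}},\qquad k\in\{0,1,\ldots,n\}.$$ These numbers form a probability distribution on $\{0,\ldots,n\}$ (the Pólya urn distribution with replacement parameter $c$). For a function $f:[0,1]\to\mathbb{R}$, the Bernstein-Stancu (also called Pólya-Stancu) operator with parameter $c$ is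 $$P_n^cf(x)=P_n^c(f;x)=\sum_{k=0}^n f\left(\frac{k}{n}\right)p_{n,k}^{x,1-x,c},$$ where $c$ is allowed to depend on $n$ and $x$. The Bernstein operator is $B_nf(x)=P_n^0f(x)=\sum_{k=0}^n f\left(\frac kn\right)\binom{n}{k}x^k(1-x)^{n-k}$; in particular $B_1f(x)=(1-x)f(0)+xf(1)$. *)

(* Defs.v *)
From mathcomp Require Import all_boot all_order all_algebra.
From mathcomp Require Import classical_sets set_interval reals convex.

Set Implicit Arguments.
Unset Strict Implicit.
Unset Printing Implicit Defensive.

Import Order.TTheory GRing.Theory Num.Theory.
Local Open Scope ring_scope.

Definition rising_factorial (R : realType) (y h : R) (m : nat) : R :=
  \prod_(i < m) (y + i%:R * h).

(* For 1 <= n, 0 <= x + (n - 1) c and 0 <= 1 - x + (n - 1) c the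
    denominator is positive; outside this range the value carries no meaning. *)
Definition polya_prob (R : realType) (n k : nat) (x c : R) : R :=
  'C(n, k)%:R * (rising_factorial x c k * rising_factorial (1 - x) c (n - k))
    / rising_factorial 1 c n.

(* A function on [0, 1] is represented by a function on R, of which only
    the values on [0, 1] are used. *)
Definition bernstein_stancu (R : realType) (n : nat) (c : R) (f : R -> R)
    (x : R) : R :=
  \sum_(k < n.+1) f (k%:R / n%:R) * polya_prob n k x c.

Definition bernstein (R : realType) (n : nat) (f : R -> R) (x : R) : R :=
  bernstein_stancu n 0 f x.

Lemma rising_factorial0 (R : realType) (y : R) (m : nat) :
  rising_factorial y 0 m = y ^+ m.
Proof.
rewrite /rising_factorial (eq_bigr (fun=> y)) => [|i _].
  by rewrite prodr_const card_ord.
by rewrite mulr0 addr0.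
Qed.

Lemma bernsteinE (R : realType) (n : nat) (f : R -> R) (x : R) :
  bernstein n f x =
  \sum_(k < n.+1) f (k%:R / n%:R) * ('C(n, k)%:R * x ^+ k * (1 - x) ^+ (n - k)).
Proof.
apply: eq_bigr => k _.
by rewrite /polya_prob !rising_factorial0 expr1n divr1 -mulrA.
Qed.

Lemma bernstein1E (R : realType) (f : R -> R) (x : R) :
  bernstein 1 f x = (1 - x) * f 0 + x * f 1.
Proof.
rewrite bernsteinE !big_ord_recl big_ord0 /= /bump /= mul0r divr1.
rewrite bin0 binn subn0 subnn !expr0 !expr1 !mul1r mulr1 addr0.
by rewrite ![f _ * _]mulrC.
Qed.

(* Main.v *)
Require Import Defs.
From mathcomp Require Import all_boot all_order all_algebra.
From mathcomp Require Import classical_sets set_interval reals convex.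
From mathcomp Require Import interval_inference zify ring lra.

(* Let d_k be the difference of the two Polya probabilities for c1 < c2.  Both
   distributions have mass 1 and mean n x, so summing by parts twice gives
   P_n^{c2} f(x) - P_n^{c1} f(x) = sum_m (Delta^2 F)_m H_{m+1}, where
   F_k = f(k/n) and H_m = sum_k max(k - m, 0) d_k; convexity of f makes the
   second differences nonnegative.  For 0 < x < 1 the ratio of the
   probabilities is log-concave in k, so the k with d_k < 0 form an interval,
   and d_0, d_n > 0; this forces H_m > 0 for 0 < m < n.  The absolute values
   disappear since f(x) <= P_n^c f(x) by Jensen's inequality. *)

Import Order.TTheory GRing.Theory Num.Theory.
Local Open Scope ring_scope.

(** * Summation by parts against hinge functions *)

(* k - m is the truncated subtraction, that is, max(k - m, 0). *)
Definition hinge_sum {R : realFieldType} (d : nat -> R) (n m : nat) : R :=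
  \sum_(k < n.+1) (k - m)%:R * d k.

Definition second_diff {R : realFieldType} (F : nat -> R) (m : nat) : R :=
  F m.+2 - 2 * F m.+1 + F m.

(** Discrete Taylor formula with remainder. Passing from [k] to [k.+1] raises each hinge by one,
    which adds the sum of the second differences so far, that is, the change of the first
    difference. *)
Lemma newton_hinge {R : realFieldType} (F : nat -> R) (k : nat) :
  F k = F 0 + k%:R * (F 1 - F 0)
        + \sum_(m < k) second_diff F m * (k - m.+1)%:R.
Proof.
have step j : F j.+1 - F j = F 1 - F 0 + \sum_(m < j) second_diff F m.
  elim: j => [|j IH]; first by rewrite big_ord0 addr0.
  rewrite big_ord_recr /= addrA -IH /second_diff; ring.
elim: k => [|k IH]; first by rewrite big_ord0; ring.
rewrite big_ord_recr /= subnn mulr0 addr0.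
rewrite (eq_bigr (fun m : 'I_k => second_diff F m * (k - m.+1)%:R
                                  + second_diff F m)); last first.
  by move=> m _; rewrite subSS -(subnSK (ltn_ord m)) mulrS; ring.
rewrite big_split /= -[LHS](subrK (F k)) step {1}IH mulrS; ring.
Qed.

(** Makes the range of summation independent of [k], so that it can be exchanged with a sum over
    [k]; the added hinges vanish by truncation. *)
Lemma newton_hinge_widen {R : realFieldType} (F : nat -> R) (n k : nat) :
  (k <= n)%N ->
  F k = F 0 + k%:R * (F 1 - F 0)
        + \sum_(m < n) second_diff F m * (k - m.+1)%:R.
Proof.
move=> kn; rewrite {1}(newton_hinge F k); congr (_ + _).
rewrite (big_ord_widen n (fun m => second_diff F m * (k - m.+1)%:R) kn).
rewrite [RHS](bigID (fun m : 'I_n => (m < k)%N)) /= [X in _ + X]big1 ?addr0 //.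
by move=> m; rewrite -leqNgt => km; rewrite (eqP (leq_trans km (leqnSn m))) mulr0.
Qed.

(** The two moment conditions kill the affine part of the expansion of [F]; exchanging the sums
    leaves the hinges. *)
Lemma sum_by_parts {R : realFieldType} (F d : nat -> R) (n : nat) :
  \sum_(k < n.+1) d k = 0 -> \sum_(k < n.+1) k%:R * d k = 0 ->
  \sum_(k < n.+1) F k * d k
  = \sum_(m < n) second_diff F m * hinge_sum d n m.+1.
Proof.
move=> d0 d1.
rewrite (eq_bigr (fun k : 'I_n.+1 => F 0 * d k + (F 1 - F 0) * (k%:R * d k)
    + \sum_(m < n) second_diff F m * ((k - m.+1)%:R * d k))); last first.
  move=> k _; rewrite {1}(newton_hinge_widen _ n k) -1?ltnS // !mulrDl mulr_suml.
  by congr (_ + _ + _); [ring | apply: eq_bigr => m _; rewrite mulrA].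
rewrite !big_split /= -!mulr_sumr d0 d1 !mulr0 !add0r exchange_big /=.
by apply: eq_bigr => m _; rewrite -mulr_sumr.
Qed.

(** The two hinges differ by the affine function [k - m], which [d] annihilates. *)
Lemma hinge_sum_reflect {R : realFieldType} (d : nat -> R) (n m : nat) :
  \sum_(k < n.+1) d k = 0 -> \sum_(k < n.+1) k%:R * d k = 0 ->
  hinge_sum d n m = \sum_(k < n.+1) (m - k)%:R * d k.
Proof.
move=> d0 d1; apply/eqP; rewrite -subr_eq0 -sumrB; apply/eqP.
rewrite (eq_bigr (fun k : 'I_n.+1 => k%:R * d k - m%:R * d k)).
  by rewrite sumrB -mulr_sumr d0 d1 mulr0 subrr.
move=> k _; rewrite -!mulrBl; congr (_ * _).
by have [h|/ltnW h] := leqP m k; rewrite (eqP h) natrB //; ring.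
Qed.

(** As a function of [m], the hinge at [k] has a single kink, at [m = k], so its second difference
    is the indicator of [k = m.+1]. *)
Lemma hinge_sum_second_diff {R : realFieldType} (d : nat -> R) (n m : nat) :
  (m < n)%N -> second_diff (hinge_sum d n) m = d m.+1.
Proof.
move=> mn; rewrite /second_diff /hinge_sum mulr_sumr -sumrB -big_split /=.
have mn' : (m.+1 < n.+1)%N by [].
rewrite (bigD1 (Ordinal mn')) //= big1 => [|k /eqP km].
  by rewrite subnn (eqP (leqnSn m.+1)) subSn // subnn; ring.
have {}km : nat_of_ord k <> m.+1 by move=> e; apply/km/val_inj.
have [h|h] := leqP k m.
  have [-> -> ->] : [/\ k - m = 0, k - m.+1 = 0 & k - m.+2 = 0]%N by split; lia.
  by ring.
have h2 : (m.+2 <= k)%N by lia.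
rewrite !natrB //; try lia.
by rewrite -![m.+2%:R]natr1 -![m.+1%:R]natr1; ring.
Qed.

(* The second difference of H = hinge_sum d n at m is d m, so H has no interior
   minimum where d < 0; elsewhere d is nonnegative on one side of m, and H m is
   a sum of nonnegative terms (after hinge_sum_reflect for the left side). *)
Lemma hinge_sum_gt0 {R : realFieldType} (d : nat -> R) (n m : nat) :
  \sum_(k < n.+1) d k = 0 -> \sum_(k < n.+1) k%:R * d k = 0 ->
  0 < d 0 -> 0 < d n ->
  (forall i j k, (i < j < k)%N -> (k <= n)%N -> d i < 0 -> d k < 0 -> d j < 0) ->
  (0 < m < n)%N -> 0 < hinge_sum d n m.
Proof.
move=> d0 d1 d0_gt0 dn_gt0 dneg mn; rewrite ltNge; apply/negP => Hm.
have H0 : hinge_sum d n 0 = 0.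
  by rewrite -[RHS]d1; apply: eq_bigr => k _; rewrite subn0.
have Hn : hinge_sum d n n = 0.
  by apply: big1 => k _; rewrite (eqP (_ : k <= n)%N) ?mul0r // -ltnS.
have [m_gt0 m_ltn] := andP mn.
have m_ltSn : (m < n.+1)%N by apply: ltnW.
pose P (j : 'I_n.+1) := (0 < j < n)%N.
have [j /andP[j_gt0 j_ltn] Hmin] :=
  @arg_minP _ R 'I_n.+1 (Ordinal m_ltSn) P (hinge_sum d n) mn.
have Hj : hinge_sum d n j <= 0 by apply: le_trans (Hmin (Ordinal m_ltSn) mn) Hm.
(* Since H vanishes at 0 and [n] while its interior minimum is at most 0, that minimum is global.
   Hence it can be compared with both neighbours of [j], even when one is an endpoint. *)
have min_all k : (k <= n)%N -> hinge_sum d n j <= hinge_sum d n k.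
  move=> kn; have [->|k_gt0] := posnP k; first by rewrite H0.
  have := kn; rewrite leq_eqVlt => /predU1P[->|k_ltn]; first by rewrite Hn.
  have k_ltSn : (k < n.+1)%N by [].
  by apply: (Hmin (Ordinal k_ltSn)); rewrite /P /= k_gt0.
have dj : 0 <= d j.
  case: (nat_of_ord j) j_gt0 j_ltn min_all => // i _ i_ltn min_all.
  rewrite -(hinge_sum_second_diff d n i) //; last exact: ltnW.
  by have := min_all i.+2 i_ltn; have := min_all i (ltnW (ltnW i_ltn));
    rewrite /second_diff; lra.
have [/forallP before|] := boolP [forall i : 'I_n.+1, (i < j)%N ==> (0 <= d i)].
  move: Hj; rewrite hinge_sum_reflect // leNgt => /negP; apply.
  rewrite big_ord_recl /= subn0 ltr_pwDl ?mulr_gt0 ?ltr0n //.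
  apply: sumr_ge0 => i _.
  have [h|h] := leqP j (lift ord0 i); first by rewrite (eqP h) mul0r.
  by apply: mulr_ge0 => //; apply: (implyP (before (lift ord0 i))).
rewrite negb_forall => /existsP[i]; rewrite negb_imply -ltNge => /andP[ij di].
have [/forallP after|] := boolP [forall k : 'I_n.+1, (j < k)%N ==> (0 <= d k)].
  move: Hj; rewrite /hinge_sum leNgt => /negP; apply.
  rewrite big_ord_recr /= ltr_wpDl ?mulr_gt0 ?ltr0n ?subn_gt0 //.
  apply: sumr_ge0 => k _.
  have [h|h] := leqP k j; first by rewrite /= (eqP h) mul0r.
  by apply: mulr_ge0 => //; apply: (implyP (after (widen_ord (leqnSn n) k))).
rewrite negb_forall => /existsP[k]; rewrite negb_imply -ltNge => /andP[jk dk].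
have := dneg i j k; rewrite ij jk di dk -ltnS ltn_ord => /(_ isT isT isT isT).
by rewrite ltNge dj.
Qed.

(** * Log-concave sequences *)

(** Successive quotients decrease, so after one strict descent the sequence never rises again. A
    descent between [i] and [j] therefore gives [s k <= s j], and its absence gives [s i <= s j]. *)
Lemma log_concave_unimodal {R : realFieldType} (s : nat -> R) (n i j k : nat) :
  (forall l, (0 < l < n)%N -> 0 < s l) ->
  (forall l, (l.+2 <= n)%N -> s l * s l.+2 <= s l.+1 ^+ 2) ->
  (i < j < k)%N -> (k <= n)%N -> Num.min (s i) (s k) <= s j.
Proof.
move=> s_gt0 s_lc /andP[ij jk] kn; rewrite leNgt lt_min; apply/negP.
move=> /andP[sji sjk].
have [/existsP[l /andP[il sl]]|] :=
    boolP [exists l : 'I_j, (i <= l)%N && (s l.+1 < s l)].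
  suff decr t : (l + t < n)%N -> s (l + t).+1 <= s (l + t)%N.
    suff : s k <= s j by rewrite leNgt sjk.
    have lj := ltn_ord l.
    have dec t : (j + t <= n)%N -> s (j + t)%N <= s j.
      elim: t => [|t IH] h; first by rewrite addn0.
      rewrite addnS in h *; apply: le_trans (IH (ltnW h)).
      have -> : (j + t = l + (j + t - l))%N by lia.
      by apply: decr; lia.
    by have := dec (k - j)%N; rewrite subnKC //; [apply | lia].
  elim: t => [|t IH] h; first by rewrite addn0 ltW.
  rewrite addnS in h *.
  have s1 : 0 < s (l + t).+1 by apply: s_gt0.
  (* The index [l + t] may be 0, where positivity is not assumed; it comes from the induction
     hypothesis and the next term. *)
  have s0 := lt_le_trans s1 (IH (ltnW h)).
  rewrite -(ler_pM2l s0); apply: le_trans (s_lc _ h) _.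
  by rewrite expr2 ler_pM2r //; apply: IH; apply: ltnW.
move/existsPn => incr.
suff inc t : (i + t <= j)%N -> s i <= s (i + t)%N.
  have := inc (j - i)%N; rewrite subnKC; last exact: ltnW.
  by rewrite leNgt sji => /(_ (leqnn _)).
elim: t => [|t IH] h; first by rewrite addn0.
rewrite addnS in h *; apply: le_trans (IH (ltnW h)) _.
by have := incr (Ordinal h); rewrite leq_addr /= -leNgt.
Qed.

(** * Convexity on the unit interval and Jensen's inequality *)

Lemma convex01P {R : realType} {f : R -> R} :
  convex_function (E := R^o) `[0, 1]%classic f ->
  forall a b t : R, 0 <= a <= 1 -> 0 <= b <= 1 -> 0 <= t <= 1 ->
  f (t * a + (1 - t) * b) <= t * f a + (1 - t) * f b.
Proof.
move=> cf a b t a01 b01 /andP[t0 t1].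
have := cf (Itv01 t0 t1) a b; rewrite !convRE /=; apply.
  by rewrite inE /= in_itv.
by rewrite inE /= in_itv.
Qed.

(** Unnormalized weights let the induction drop the last point without rescaling; the step is
    two-point convexity for the earlier barycentre and the new point. *)
Lemma jensen01 {R : realType} {f : R -> R} (m : nat) (w t : nat -> R) :
  convex_function (E := R^o) `[0, 1]%classic f ->
  (forall i, (i < m)%N -> 0 <= w i) -> (forall i, (i < m)%N -> 0 <= t i <= 1) ->
  0 < \sum_(i < m) w i ->
  f ((\sum_(i < m) w i * t i) / \sum_(i < m) w i) * \sum_(i < m) w i
  <= \sum_(i < m) w i * f (t i).
Proof.
move=> cf; elim: m => [|m IH] w0 t01; first by rewrite big_ord0 ltxx.
rewrite !big_ord_recr /=.
have w0' i : (i < m)%N -> 0 <= w i by move=> h; apply/w0/ltnW.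
have t01' i : (i < m)%N -> 0 <= t i <= 1 by move=> h; apply/t01/ltnW.
have := IH w0' t01'.
set W := \sum_(i < m) w i; set T := \sum_(i < m) w i * t i.
set S := \sum_(i < m) w i * f (t i).
have : 0 <= W by apply: sumr_ge0 => i _; apply: w0'.
rewrite le_eqVlt => /predU1P[W0 _|W_gt0 /(_ W_gt0) {}IH] Ww_gt0.
  (* If the earlier weights sum to zero, each of them vanishes and only the last point counts. *)
  have wz (i : 'I_m) : w i = 0.
    by apply: (psumr_eq0P _ (esym W0)) => // j _; apply: w0'.
  have -> : T = 0 by apply: big1 => i _; rewrite wz mul0r.
  have -> : S = 0 by apply: big1 => i _; rewrite wz mul0r.
  move: Ww_gt0; rewrite -W0 !add0r => wm.
  by rewrite [w m * t m]mulrC mulfK ?gt_eqF // mulrC.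
have wm := w0 m (leqnn _).
have T01 : 0 <= T / W <= 1.
  rewrite divr_ge0 ?(ltW W_gt0) //=; last first.
    by apply: sumr_ge0 => i _; rewrite mulr_ge0 ?w0' //; case/andP: (t01' i (ltn_ord i)).
  rewrite ler_pdivrMr // mul1r; apply: ler_sum => i _.
  by case/andP: (t01' i (ltn_ord i)) => _ ti; rewrite ler_piMr ?w0'.
have q01 : 0 <= W / (W + w m) <= 1.
  by rewrite divr_ge0 ?(ltW W_gt0) ?(ltW Ww_gt0) //= ler_pdivrMr // mul1r lerDl.
have W0 : W != 0 by rewrite gt_eqF.
have Ww0 : W + w m != 0 by rewrite gt_eqF.
have := convex01P cf _ _ _ T01 (t01 m (leqnn _)) q01.
have -> : W / (W + w m) * (T / W) + (1 - W / (W + w m)) * t m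
          = (T + w m * t m) / (W + w m) by field; apply/andP.
rewrite -(ler_pM2r Ww_gt0) => /le_trans; apply.
have -> : (W / (W + w m) * f (T / W) + (1 - W / (W + w m)) * f (t m)) * (W + w m)
          = f (T / W) * W + w m * f (t m) by field.
by rewrite lerD2r.
Qed.

(** * Rising factorials and the Vandermonde identity *)

Lemma rising_factorialSr {R : realType} (y h : R) (m : nat) :
  rising_factorial y h m.+1 = rising_factorial y h m * (y + m%:R * h).
Proof. exact: big_ord_recr. Qed.

Lemma rising_factorialSl {R : realType} (y h : R) (m : nat) :
  rising_factorial y h m.+1 = y * rising_factorial (y + h) h m.
Proof.
rewrite /rising_factorial big_ord_recl mul0r addr0; congr (_ * _).
by apply: eq_bigr => i _; rewrite lift0 -natr1; ring.
Qed.

Lemma rising_factorial_ge0 {R : realType} (y h : R) (m : nat) :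
  (forall i, (i < m)%N -> 0 <= y + i%:R * h) -> 0 <= rising_factorial y h m.
Proof. by move=> yh; apply: prodr_ge0 => i _; apply: yh. Qed.

Lemma rising_factorial_gt0 {R : realType} (y h : R) (m : nat) :
  (forall i, (i < m)%N -> 0 < y + i%:R * h) -> 0 < rising_factorial y h m.
Proof. by move=> yh; apply: prodr_gt0 => i _; apply: yh. Qed.

(** By Pascal's rule, each term of degree [n] is multiplied by [(a + k h) + (b + (n - k) h) = a + b
    + n h], which is the next factor on the right. *)
Lemma rising_factorial_vandermonde {R : realType} (a b h : R) (n : nat) :
  \sum_(k < n.+1) 'C(n, k)%:R * (rising_factorial a h k * rising_factorial b h (n - k))
  = rising_factorial (a + b) h n.
Proof.
elim: n => [|n IH].
  by rewrite big_ord_recl big_ord0 /rising_factorial !big_ord0 bin0; ring.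
pose A := rising_factorial a h; pose B := rising_factorial b h.
(* Reindexes the half of Pascal's rule with ['C(n, k.+1)]; the extra top term has
   ['C(n, n.+1) = 0]. *)
have shift : \sum_(k < n.+1) 'C(n, k.+1)%:R * (A k.+1 * B (n - k)%N)
    + A 0 * B n.+1 = \sum_(k < n.+1) 'C(n, k)%:R * (A k * B (n.+1 - k)%N).
  transitivity (\sum_(k < n.+2) 'C(n, k)%:R * (A k * B (n.+1 - k)%N)).
    by rewrite [RHS]big_ord_recl bin0 subn0 mul1r addrC.
  by rewrite big_ord_recr /= bin_small // mul0r addr0.
rewrite big_ord_recl /= bin0 subn0 mul1r -/A -/B.
under eq_bigr => k _ do rewrite binS natrD mulrDl subSS -/(A _) -/(B _).
rewrite big_split /= addrA [_ + \sum_(k < n.+1) 'C(n, k.+1)%:R * _]addrC shift.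
rewrite -big_split /= rising_factorialSr -IH mulr_suml.
apply: eq_bigr => k _; have kn : (k <= n)%N by rewrite -ltnS.
rewrite subSn // /A /B !rising_factorialSr natrB //; ring.
Qed.

(** * Admissible parameters; mass and mean of the Polya distribution *)

Definition polya_admissible {R : realType} (n : nat) (x c : R) :=
  forall i, (i < n)%N -> 0 <= x + i%:R * c /\ 0 <= 1 - x + i%:R * c.

(** Each factor is affine in [i], so it suffices to check [i = 0] and [i = n - 1]; the latter is the
    bound on [c]. *)
Lemma polya_admissibleP {R : realType} (n : nat) (x c : R) :
  (2 <= n)%N -> 0 <= x <= 1 ->
  - (n%:R - 1)^-1 * Num.min x (1 - x) <= c -> polya_admissible n x c.
Proof.
move=> n2 /andP[x0 x1] hc i i_ltn.
have N0 : 0 < n%:R - 1 :> R by rewrite subr_gt0 ltr1n.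
have iN : i%:R <= n%:R - 1 :> R by rewrite lerBrDr natr1 ler_nat.
move: hc; rewrite mulNr lerNl ler_pdivlMl // => hc.
have {}hc : - Num.min x (1 - x) <= (n%:R - 1) * c by lra.
have i0 : 0 <= i%:R :> R by [].
have key y : 0 <= y -> 0 <= y + (n%:R - 1) * c -> 0 <= y + i%:R * c.
  move=> y0 yc; have [c0|c0] := leP 0 c; first by rewrite addr_ge0 // mulr_ge0.
  by apply: le_trans yc _; rewrite lerD2l ler_wnM2r // ltW.
have mx : Num.min x (1 - x) <= x by rewrite ge_min lexx.
have my : Num.min x (1 - x) <= 1 - x by rewrite ge_min lexx orbT.
by split; apply: key; lra.
Qed.

Lemma polya_admissible0 {R : realType} (n : nat) (x : R) :
  0 <= x <= 1 -> polya_admissible n x 0.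
Proof. by move=> /andP[x0 x1] i _; rewrite mulr0 !addr0 subr_ge0. Qed.

Lemma polya_admissible_trans {R : realType} {n : nat} {x c1 c2 : R} :
  polya_admissible n x c1 -> c1 <= c2 -> polya_admissible n x c2.
Proof.
move=> adm c12 i /adm[h1 h2].
have : i%:R * c1 <= i%:R * c2 by rewrite ler_wpM2l.
by split; lra.
Qed.

Lemma polya_admissible_denom {R : realType} {n : nat} {x c : R} :
  polya_admissible n x c -> forall i, (i < n)%N -> 0 < 1 + i%:R * c.
Proof. by move=> adm i /adm[h1 h2]; lra. Qed.

Lemma polya_prob_ge0 {R : realType} {n : nat} {x c : R} (k : nat) :
  polya_admissible n x c -> (k <= n)%N -> 0 <= polya_prob n k x c.
Proof.
move=> adm kn; rewrite divr_ge0 ?mulr_ge0 //; apply: rising_factorial_ge0 => i h.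
- by have [] := adm i (leq_trans h kn).
- by have [] := adm i (leq_trans h (leq_subr _ _)).
- exact: ltW (polya_admissible_denom adm i h).
Qed.

Lemma polya_prob_sum {R : realType} {n : nat} {x c : R} :
  polya_admissible n x c -> \sum_(k < n.+1) polya_prob n k x c = 1.
Proof.
move=> adm; rewrite -mulr_suml rising_factorial_vandermonde addrC subrK divff //.
by rewrite gt_eqF // rising_factorial_gt0 //; apply: polya_admissible_denom adm.
Qed.

(** Absorbing [k] into the binomial coefficient and splitting off the factor [x] leaves a
    Vandermonde sum with [x + c] in place of [x]. *)
Lemma polya_prob_mean {R : realType} {n : nat} {x c : R} :
  polya_admissible n x c -> \sum_(k < n.+1) k%:R * polya_prob n k x c = n%:R * x.
Proof.
case: n => [|n] adm; first by rewrite big_ord_recl big_ord0 !mul0r addr0.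
have Z0 : rising_factorial 1 c n.+1 != 0.
  by rewrite gt_eqF // rising_factorial_gt0 //; apply: polya_admissible_denom adm.
rewrite big_ord_recl mul0r add0r.
rewrite (eq_bigr (fun k : 'I_n.+1 => n.+1%:R * x / rising_factorial 1 c n.+1 *
    ('C(n, k)%:R * (rising_factorial (x + c) c k
                    * rising_factorial (1 - x) c (n - k))))); last first.
  move=> k _; rewrite lift0 /polya_prob subSS rising_factorialSl.
  have : k.+1%:R * 'C(n.+1, k.+1)%:R = n.+1%:R * 'C(n, k)%:R :> R.
    by rewrite -!natrM mul_bin_diag.
  by move=> e; rewrite !mulrA e; ring.
rewrite -mulr_sumr rising_factorial_vandermonde.
have -> : x + c + (1 - x) = 1 + c by ring.
by rewrite -[rising_factorial (1 + c) c n]mul1r -rising_factorialSl divfK.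
Qed.

(** * Rising factorials with two different increments *)

Lemma progression_gt0_incr {R : realType} (y c c' : R) (i : nat) :
  0 < y -> c < c' -> 0 <= y + i%:R * c -> 0 < y + i%:R * c'.
Proof.
move=> y0 cc'; case: i => [|i] h; first by rewrite mul0r addr0.
by apply: le_lt_trans h _; rewrite ltrD2l ltr_pM2l.
Qed.

Lemma progression_gt0_pred {R : realType} (y c : R) (i : nat) :
  0 < y -> 0 <= y + i.+1%:R * c -> 0 < y + i%:R * c.
Proof.
move=> y0; rewrite -natr1 mulrDl mul1r => h.
have [c0|c0] := leP 0 c; first by rewrite ltr_wpDr // mulr_ge0.
by lra.
Qed.

(** The quotient of consecutive terms, [(y + i c1) / (y + i c2)], decreases in [i]. The lower bound
    0 allows two such inequalities to be multiplied later. *)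
Lemma rising_factorial_ratio_log_concave {R : realType} (y c1 c2 : R) (n j : nat)
    (u := fun k => rising_factorial y c1 k / rising_factorial y c2 k) :
  0 < y -> c1 < c2 -> (forall i, (i < n)%N -> 0 <= y + i%:R * c1) ->
  (j.+2 <= n)%N -> 0 <= u j * u j.+2 <= u j.+1 ^+ 2.
Proof.
move=> y0 c12 h1 jn.
have h2 i : (i < n)%N -> 0 < y + i%:R * c2.
  by move=> /h1; apply: progression_gt0_incr.
have u0 : 0 <= u j.
  apply: divr_ge0; apply: rising_factorial_ge0 => i h; first by apply: h1; lia.
  by apply/ltW/h2; lia.
pose t i := (y + i%:R * c1) / (y + i%:R * c2).
have t0 i : (i < n)%N -> 0 <= t i by move=> h; apply: divr_ge0; [exact: h1 | exact/ltW/h2].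
have uS i : u i.+1 = u i * t i.
  by rewrite /u /t !rising_factorialSr invfM; ring.
have tS : t j.+1 <= t j.
  rewrite ler_pdivrMr ?h2 // mulrAC ler_pdivlMr ?h2 ?(ltnW jn) //.
  rewrite -natr1 -subr_ge0.
  rewrite [X in 0 <= X](_ : _ = y * (c2 - c1)); last by ring.
  by rewrite mulr_ge0 ?subr_ge0 ?ltW.
have [tj0 tj1] := (t0 j (ltnW jn), t0 j.+1 jn).
clearbody u t; rewrite !uS; apply/andP; split; first by rewrite !mulr_ge0.
rewrite -subr_ge0.
rewrite [X in 0 <= X](_ : _ = u j ^+ 2 * t j * (t j - t j.+1)); last by ring.
by rewrite !mulr_ge0 ?subr_ge0 // sqr_ge0.
Qed.

(** Each factor [(y + i c) / (1 + i c)] with [i > 0] increases strictly in [c] because [y < 1].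
    Taking [y] to be [1 - x] and [x] yields [d 0 > 0] and [d n > 0]. *)
Lemma rising_factorial_div1_lt {R : realType} (y c1 c2 : R) (n : nat) :
  0 < y < 1 -> c1 < c2 -> (2 <= n)%N ->
  (forall i, (i < n)%N -> 0 <= y + i%:R * c1) ->
  rising_factorial y c1 n / rising_factorial 1 c1 n
  < rising_factorial y c2 n / rising_factorial 1 c2 n.
Proof.
case: n => [|[|n]] // /andP[y0 y1] c12 _ h.
pose t c i := (y + i%:R * c) / (1 + i%:R * c).
have tE c : rising_factorial y c n.+2 / rising_factorial 1 c n.+2
            = y * \prod_(i < n.+1) t c i.+1.
  by rewrite /rising_factorial -prodf_div [LHS]big_ord_recl /= !mul0r !addr0 divr1.
rewrite !tE ltr_pM2l //; apply: ltr_prod.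
  (* A strict inequality of products needs a factor: the one for [i = 0] was split off, and [n >= 2]
     leaves at least one. *)
  by apply/hasP; exists ord0 => //; rewrite mem_index_enum.
move=> i _; have hi := h i.+1 (ltn_ord i).
have ic : i.+1%:R * c1 < i.+1%:R * c2 by rewrite ltr_pM2l.
have d1 : 0 < 1 + i.+1%:R * c1 by lra.
have d2 : 0 < 1 + i.+1%:R * c2 by lra.
rewrite divr_ge0 ?(ltW d1) //= ltr_pdivrMr // mulrAC ltr_pdivlMr // -subr_gt0.
rewrite [X in 0 < X](_ : _ = (i.+1%:R * c2 - i.+1%:R * c1) * (1 - y)); last by ring.
by rewrite mulr_gt0 // subr_gt0.
Qed.

Lemma polya_prob_gt0 {R : realType} {n : nat} {x c : R} (k : nat) :
  polya_admissible n x c -> (k <= n)%N ->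
  (forall i, (i < k)%N -> 0 < x + i%:R * c) ->
  (forall i, (i < n - k)%N -> 0 < 1 - x + i%:R * c) ->
  0 < polya_prob n k x c.
Proof.
move=> adm kn hx hy; rewrite divr_gt0 ?mulr_gt0 ?ltr0n ?bin_gt0 //.
- exact: rising_factorial_gt0.
- exact: rising_factorial_gt0.
- exact: rising_factorial_gt0 (polya_admissible_denom adm).
Qed.

(** * Comparison of two Polya distributions at an interior point *)

Section Comparison.

Variables (R : realType) (n : nat) (x c1 c2 : R).
Hypotheses (n2 : (2 <= n)%N) (x01 : 0 < x < 1).
Hypotheses (adm1 : polya_admissible n x c1) (c12 : c1 < c2).

Let adm2 : polya_admissible n x c2.
Proof. exact: polya_admissible_trans adm1 (ltW c12). Qed.

Let x_gt0 : 0 < x. Proof. by case/andP: x01. Qed.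
Let y_gt0 : 0 < 1 - x. Proof. by rewrite subr_gt0; case/andP: x01. Qed.

Let p1 k := polya_prob n k x c1.
Let p2 k := polya_prob n k x c2.
Let d k := p2 k - p1 k.

Let p2_gt0 k : (k <= n)%N -> 0 < p2 k.
Proof.
move=> kn; apply: polya_prob_gt0 => // i h; apply: (progression_gt0_incr _ c1) => //.
  by have [] := adm1 i (leq_trans h kn).
by have [] := adm1 i (leq_trans h (leq_subr _ _)).
Qed.

(** The endpoints are excluded because for the least admissible [c1] the last factor of a rising
    factorial of length [n] may vanish. *)
Let p1_gt0 k : (0 < k < n)%N -> 0 < p1 k.
Proof.
move=> /andP[k0 kn]; apply: polya_prob_gt0 => //; first exact: ltnW.
  by move=> i h; apply: progression_gt0_pred => //; have [|//] := adm1 i.+1; lia.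
by move=> i h; apply: progression_gt0_pred => //; have [|//] := adm1 i.+1; lia.
Qed.

Let u y k := rising_factorial y c1 k / rising_factorial y c2 k.

Let ratioE k : (k <= n)%N ->
  p1 k / p2 k = rising_factorial 1 c2 n / rising_factorial 1 c1 n
                * (u x k * u (1 - x) (n - k)).
Proof.
move=> kn.
have Cn0 : 'C(n, k)%:R != 0 :> R by rewrite pnatr_eq0 -lt0n bin_gt0.
have Z1 : rising_factorial 1 c1 n != 0.
  by rewrite gt_eqF // rising_factorial_gt0 //; apply: polya_admissible_denom adm1.
have Z2 : rising_factorial 1 c2 n != 0.
  by rewrite gt_eqF // rising_factorial_gt0 //; apply: polya_admissible_denom adm2.
have X2 : rising_factorial x c2 k != 0.
  rewrite gt_eqF // rising_factorial_gt0 // => i h.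
  by apply: progression_gt0_incr c12 _ => //; have [|//] := adm1 i; lia.
have Y2 : rising_factorial (1 - x) c2 (n - k) != 0.
  rewrite gt_eqF // rising_factorial_gt0 // => i h.
  by apply: progression_gt0_incr c12 _ => //; have [|//] := adm1 i; lia.
by rewrite /p1 /p2 /polya_prob /u; field; rewrite Cn0 Z1 Z2 X2 Y2.
Qed.

(** By [ratioE] the ratio is a constant times a log-concave sequence in [k] and another one read
    backwards. *)
Let ratio_log_concave l : (l.+2 <= n)%N ->
  p1 l / p2 l * (p1 l.+2 / p2 l.+2) <= (p1 l.+1 / p2 l.+1) ^+ 2.
Proof.
move=> ln; rewrite !ratioE //; [|lia|lia].
have hx i : (i < n)%N -> 0 <= x + i%:R * c1 by move=> /adm1[].
have hy i : (i < n)%N -> 0 <= 1 - x + i%:R * c1 by move=> /adm1[].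
have := rising_factorial_ratio_log_concave _ _ _ _ _ x_gt0 c12 hx ln.
(* The reversed triple starts at [n - l.+2]. *)
have nl : ((n - l.+2).+2 <= n)%N by lia.
have := rising_factorial_ratio_log_concave _ _ _ _ _ y_gt0 c12 hy nl.
have [-> ->] : (n - l.+2).+2 = (n - l)%N /\ (n - l.+2).+1 = (n - l.+1)%N by lia.
rewrite -!/(u _ _) => /andP[v0 v1] /andP[u0 u1].
set K := _ / _; rewrite exprMn [_ ^+ 2 in leRHS]expr2.
rewrite [leLHS](_ : _ = K * K * ((u x l * u x l.+2)
    * (u (1 - x) (n - l.+2) * u (1 - x) (n - l)))); last by ring.
rewrite [K * K]/(K ^+ 2) exprMn ler_wpM2l ?sqr_ge0 //.
by apply: ler_pM.
Qed.

Let d_sum : \sum_(k < n.+1) d k = 0.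
Proof. by rewrite sumrB !polya_prob_sum // subrr. Qed.

Let d_mean : \sum_(k < n.+1) k%:R * d k = 0.
Proof.
under eq_bigr do rewrite mulrBr.
by rewrite sumrB !polya_prob_mean // subrr.
Qed.

Lemma polya_hinge_gt0 (m : nat) : (0 < m < n)%N -> 0 < hinge_sum d n m.
Proof.
apply: hinge_sum_gt0 => //.
- rewrite /d subr_gt0 /p1 /p2 /polya_prob bin0 subn0 !mul1r.
  rewrite /rising_factorial !big_ord0 !mul1r.
  apply: rising_factorial_div1_lt => //.
    by rewrite y_gt0 ltrBlDr ltrDl x_gt0.
  by move=> i /adm1[].
- rewrite /d subr_gt0 /p1 /p2 /polya_prob binn subnn !mul1r.
  rewrite ![rising_factorial (1 - x) _ 0]/rising_factorial !big_ord0 !mulr1.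
  by apply: rising_factorial_div1_lt => // i /adm1[].
- move=> i j k ijk kn; have [ij jk] := andP ijk.
  have dE l : (l <= n)%N -> (d l < 0) = (1 < p1 l / p2 l).
    by move=> /p2_gt0 pl; rewrite subr_lt0 [RHS]ltr_pdivlMr // mul1r.
  rewrite !dE //; [|lia|lia] => si sk.
  have := log_concave_unimodal (fun l => p1 l / p2 l) n i j k.
  move=> /(_ _ ratio_log_concave ijk kn) h.
  apply: lt_le_trans (h _); first by rewrite lt_min si sk.
  by move=> l ln; rewrite divr_gt0 ?p1_gt0 ?p2_gt0 //; lia.
Qed.

Lemma bernstein_stancu_diff (f : R -> R) :
  bernstein_stancu n c2 f x - bernstein_stancu n c1 f x
  = \sum_(m < n.-1) second_diff (fun k => f (k%:R / n%:R)) m * hinge_sum d n m.+1.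
Proof.
rewrite -sumrB.
under eq_bigr do rewrite -mulrBr.
rewrite (sum_by_parts (fun k => f (k%:R / n%:R)) d n) //.
(* The last term drops out because the hinge sum at [n] is zero; the remaining second differences
   only use grid points in [[0, 1]]. *)
have nE : n = n.-1.+1 by lia.
rewrite [in LHS]nE big_ord_recr /= -nE [X in _ * X]big1 ?mulr0 ?addr0 //.
by move=> k _; rewrite (eqP (_ : k <= n)%N) ?mul0r // -ltnS.
Qed.

End Comparison.

(** * Convex functions on the grid, endpoints, and the affine case *)

Lemma second_diff_grid_ge0 {R : realType} {f : R -> R} {n : nat} (m : nat) :
  convex_function (E := R^o) `[0, 1]%classic f -> (m.+2 <= n)%N ->
  0 <= second_diff (fun k => f (k%:R / n%:R)) m.
Proof.
move=> cf mn; have n0 : 0 < n%:R :> R by rewrite ltr0n; lia.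
have grid k : (k <= n)%N -> 0 <= (k%:R / n%:R : R) <= 1.
  by move=> kn; rewrite divr_ge0 //= ler_pdivrMr // mul1r ler_nat.
have half01 : 0 <= (2^-1 : R) <= 1 by lra.
have := convex01P cf _ _ _ (grid m (ltnW (ltnW mn))) (grid m.+2 mn) half01.
have -> : 2^-1 * (m%:R / n%:R) + (1 - 2^-1) * (m.+2%:R / n%:R) = m.+1%:R / n%:R :> R.
  by rewrite -[m.+2%:R]natr1 -[m.+1%:R]natr1; field; rewrite gt_eqF.
by rewrite /second_diff; lra.
Qed.

Lemma bernstein_stancu_ge {R : realType} {f : R -> R} {n : nat} {x c : R} :
  convex_function (E := R^o) `[0, 1]%classic f -> (0 < n)%N ->
  polya_admissible n x c -> f x <= bernstein_stancu n c f x.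
Proof.
move=> cf n0 adm; have n0' : n%:R != 0 :> R by rewrite pnatr_eq0 -lt0n.
have := jensen01 n.+1 (fun k => polya_prob n k x c) (fun k => k%:R / n%:R) cf.
rewrite (polya_prob_sum adm) divr1 mulr1 => jen.
rewrite /bernstein_stancu; under eq_bigr do rewrite mulrC.
apply: le_trans (jen _ _ ltr01) => [|i|i].
- rewrite (eq_bigr (fun k : 'I_n.+1 => n%:R^-1 * (k%:R * polya_prob n k x c))).
    by rewrite -mulr_sumr polya_prob_mean // mulKf.
  by move=> k _; ring.
- by move=> h /=; apply: polya_prob_ge0 adm _.
- by rewrite ltnS => h; rewrite divr_ge0 //= ler_pdivrMr ?ltr0n // mul1r ler_nat.
Qed.

(** All terms with [k > 0] contain the factor [x = 0]. The endpoints are treated apart, since the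
    comparison requires [0 < x < 1]. *)
Lemma bernstein_stancu_at0 {R : realType} (f : R -> R) (n : nat) (c : R) :
  (0 < n)%N -> polya_admissible n 0 c -> bernstein_stancu n c f 0 = f 0.
Proof.
move=> n0 adm; rewrite /bernstein_stancu big_ord_recl big1 => [|k _].
  rewrite /polya_prob bin0 subn0 subr0 mul1r /= mul0r {1}/rising_factorial big_ord0.
  rewrite mul1r divff ?addr0 ?mulr1 // gt_eqF // rising_factorial_gt0 //.
  exact: polya_admissible_denom adm.
by rewrite lift0 /polya_prob rising_factorialSl !(mul0r, mulr0).
Qed.

Lemma bernstein_stancu_at1 {R : realType} (f : R -> R) (n : nat) (c : R) :
  (0 < n)%N -> polya_admissible n 1 c -> bernstein_stancu n c f 1 = f 1.
Proof.
move=> n0 adm; rewrite /bernstein_stancu big_ord_recr big1 /= => [|k _].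
  rewrite /polya_prob binn subnn mul1r [rising_factorial (1 - 1) c 0]big_ord0.
  rewrite mulr1 add0r divff ?pnatr_eq0 -?lt0n // divff ?mulr1 //.
  by rewrite gt_eqF // rising_factorial_gt0 //; apply: polya_admissible_denom adm.
by rewrite /polya_prob subrr -(subnSK (ltn_ord k)) rising_factorialSl !(mul0r, mulr0).
Qed.

(** Serves the strict case by contraposition: an [f] affine on the grid is averaged to its chord at
    [x], because the mean is [n x]. *)
Lemma bernstein_affine {R : realType} (f : R -> R) (n : nat) (x : R) :
  (0 < n)%N -> 0 <= x <= 1 ->
  (forall m, (m < n.-1)%N -> second_diff (fun k => f (k%:R / n%:R)) m = 0) ->
  bernstein n f x = bernstein 1 f x.
Proof.
move=> n0 /andP[x0 x1] aff; pose F k := f (k%:R / n%:R).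
have n0' : n%:R != 0 :> R by rewrite pnatr_eq0 -lt0n.
have FE k : (k <= n)%N -> F k = F 0 + k%:R * (F 1 - F 0).
  move=> kn; rewrite {1}(newton_hinge F k) big1 ?addr0 // => m _.
  (* The only index outside the hypothesis is [m = n.-1] with [k = n], whose hinge is zero. *)
  have [mn|mn] := ltnP m n.-1; first by rewrite aff ?mul0r.
  have -> : (k - m.+1 = 0)%N by have := ltn_ord m; lia.
  by rewrite mulr0.
have adm : polya_admissible n x 0 by apply: polya_admissible0; rewrite x0.
rewrite bernstein1E /bernstein /bernstein_stancu.
rewrite (eq_bigr (fun k : 'I_n.+1 => F 0 * polya_prob n k x 0
    + (F 1 - F 0) * (k%:R * polya_prob n k x 0))); last first.
  by move=> k _; rewrite -/(F k) FE -1?ltnS //; ring.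
rewrite big_split /= -!mulr_sumr polya_prob_sum // polya_prob_mean // mulr1.
have f0 : f 0 = F 0 by rewrite /F mul0r.
have f1 : f 1 = F n by rewrite /F divff.
by rewrite f0 f1 (FE n) //; ring.
Qed.

Theorem theorem4p1 (R : realType) (f : R -> R)
    (f_convex : convex_function (E := R^o) `[0, 1]%classic f) :
  (forall (n : nat) (x c1 c2 : R),
     (2 <= n)%N -> 0 <= x <= 1 ->
     - (n%:R - 1)^-1 * Num.min x (1 - x) <= c1 -> c1 < c2 ->
     `|bernstein_stancu n c1 f x - f x| <= `|bernstein_stancu n c2 f x - f x|)
  /\
  (forall (n : nat) (x : R),
     (2 <= n)%N -> 0 <= x <= 1 ->
     bernstein n f x <> bernstein 1 f x ->
     forall c1 c2 : R,
       - (n%:R - 1)^-1 * Num.min x (1 - x) <= c1 -> c1 < c2 ->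
       `|bernstein_stancu n c1 f x - f x| < `|bernstein_stancu n c2 f x - f x|).
Proof.
have gt0 n : (2 <= n)%N -> (0 < n)%N by apply: leq_trans.
have normE n x c : (2 <= n)%N -> polya_admissible n x c ->
    `|bernstein_stancu n c f x - f x| = bernstein_stancu n c f x - f x.
  move=> n2 adm; rewrite ger0_norm // subr_ge0.
  exact: bernstein_stancu_ge f_convex (gt0 _ n2) adm.
have endpoint n x c : (0 < n)%N -> 0 <= x <= 1 -> ~~ (0 < x < 1) ->
    polya_admissible n x c -> bernstein_stancu n c f x = f x.
  move=> n0; rewrite !le_eqVlt => /andP[/predU1P[<-|x0] x1] xb adm.
    exact: bernstein_stancu_at0.
  move: x1 adm; rewrite x0 /= in xb; rewrite (negbTE xb) orbF => /eqP ->.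
  exact: bernstein_stancu_at1.
split=> [n x c1 c2 n2 x01 hc c12 | n x n2 x01 Bn c1 c2 hc c12];
  have adm1 := polya_admissibleP _ _ _ n2 x01 hc;
  have adm2 := polya_admissible_trans adm1 (ltW c12).
  have [xi|xb] := boolP (0 < x < 1); last by rewrite !endpoint ?gt0.
  rewrite !normE // lerD2r -subr_ge0 bernstein_stancu_diff //.
  apply: sumr_ge0 => m _; apply: mulr_ge0.
    by apply: second_diff_grid_ge0 => //; have := ltn_ord m; lia.
  by apply/ltW/polya_hinge_gt0 => //; have := ltn_ord m; lia.
have [xi|xb] := boolP (0 < x < 1); last first.
  (* At an endpoint both Bernstein values equal [f x], against [Bn]. *)
  by case: Bn; rewrite /bernstein !endpoint ?(gt0 _ n2) //; apply: polya_admissible0.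
rewrite !normE // ltrD2r -subr_gt0 bernstein_stancu_diff //.
have e_ge0 (m : 'I_n.-1) : 0 <= second_diff (fun k => f (k%:R / n%:R)) m.
  by apply: second_diff_grid_ge0 => //; have := ltn_ord m; lia.
have H_gt0 (m : 'I_n.-1) :
    0 < hinge_sum (fun k => polya_prob n k x c2 - polya_prob n k x c1) n m.+1.
  by apply: polya_hinge_gt0 => //; have := ltn_ord m; lia.
have term_ge0 (m : 'I_n.-1) : true -> 0 <= second_diff (fun k => f (k%:R / n%:R)) m
    * hinge_sum (fun k => polya_prob n k x c2 - polya_prob n k x c1) n m.+1.
  by move=> _; rewrite mulr_ge0 // ltW.
(* If the sum of nonnegative terms were zero, the positive hinge sums would force all second
   differences to vanish, contradicting [Bn]. *)
rewrite lt_neqAle sumr_ge0 // andbT eq_sym; apply/eqP => sum0.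
apply: Bn; apply: bernstein_affine (gt0 _ n2) x01 _ => m mn.
have /eqP := psumr_eq0P term_ge0 sum0 (i := Ordinal mn) isT.
by rewrite mulf_eq0 (gt_eqF (H_gt0 _)) orbF => /eqP.
Qed.
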